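(* Let $(S,\preceq,\lambda)$ be a standard poset, let $\boldsymbol{X}=(X_1,X_2,\ldots)$ be an IID sequence in $S$ from a distribution with constant rate $\alpha$ and upper probability function $F$, and let $\boldsymbol{Y}=(Y_1,Y_2,\ldots)$ be the corresponding sequence of ladder variables. Suppose that $\boldsymbol{Y}$ is thinned with probability $p\in(0,1)$: each point is accepted with probability $p$ and rejected with probability $1-p$, independently from point to point, and let $Y_M$ be the first accepted point (so $M$ is independent of $\boldsymbol{Y}$ and has the geometric distribution on $\{1,2,\ldots\}$ with parameter $p$). Then the PDF $g$ of $Y_M$ is $$g(x)=p\,\alpha\,\Lambda\bigl(x,\alpha(1-p)\bigr)\,F(x),\qquad x\in S.$$
   Context: For a poset $(S,\preceq)$ let $D[x]=\{t\in S: t\preceq x\}$ and $D_n[x]=\{(x_1,\ldots,x_n)\in S^n: x_1\preceq\cdots\preceq x_n\preceq x\}$. A standard poset $(S,\preceq,\lambda)$ is a poset with a topology and a Borel measure such that: $S$ is locally compact, locally convex (every point has a neighborhood base of convex sets, where $A$ is convex if $a,b\in A$, $a\preceq x\preceq b$ imply $x\in A$) and has a countable base; $\{(x,y)\in S^2: x\preceq y\}$ is closed in $S^2$; $D[x]$ is compact for each $x\in S$; $\lambda$ is a positive Borel measure, finite on compact sets, with $\lambda(V)>0$ for every nonempty open $V$. PDFs are with respect to $\lambda$. Random variables in $S$ have a Borel distribution with support $S$; the upper probability function is $F(x)=\mathbb{P}(X\succeq x)$, assumed to take values in $(0,1]$. The distribution has constant rate $\alpha>0$ if $\alpha F$ is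 a PDF of $X$. The cumulative functions are $\lambda_0=1$ and $\lambda_n(x)=\lambda^n(D_n[x])$ for $n\ge1$, where $\lambda^n$ is the product measure; their generating function is $\Lambda(x,t)=\sum_{n=0}^\infty\lambda_n(x)t^n$. Ladder variables: $N_1=1$, $Y_1=X_1$, and recursively $N_{n+1}=\min\{k>N_n: X_k\succeq Y_n\}$, $Y_{n+1}=X_{N_{n+1}}$. *)

(* Defs.v *)
From mathcomp Require Import all_boot all_order all_algebra.
From mathcomp Require Import all_classical all_reals all_analysis.
From mathcomp Require Import measurable_realfun.

Set Implicit Arguments.
Unset Strict Implicit.
Unset Printing Implicit Defensive.

Import Order.TTheory GRing.Theory Num.Theory.

Local Open Scope classical_set_scope.
Local Open Scope ring_scope.
Local Open Scope ereal_scope.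

(* A poset that is also a topological space, with no relation between the two
   structures. Pointedness (nonemptiness) is what [g_sigma_algebraType]
   requires to build a measurable type. *)
Notation topPosetType := POrderedPointedTopological.type.

Notation borel S := (g_sigma_algebraType (@open S)).

Section standard_posets.
Context {R : realType} {dS : Order.disp_t} {S : topPosetType dS}.
Implicit Types lam : {measure set (borel S) -> \bar R}.

Definition order_convex (A : set S) : Prop :=
  forall a b x : S, A a -> A b -> (a <= x)%O -> (x <= b)%O -> A x.

Definition down_set (x : S) : set S := [set t : S | (t <= x)%O].

Record standard_poset lam : Prop := StandardPoset {
  standard_locally_compact : locally_compact [set: S] ;
  standard_locally_convex : forall (x : S) (U : set S), nbhs x U ->
    exists V : set S, [/\ nbhs x V, V `<=` U & order_convex V] ;
  standard_second_countable : @second_countable S ;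
  standard_closed_order : closed [set z : S * S | (z.1 <= z.2)%O] ;
  standard_compact_down_set : forall x : S, compact (down_set x) ;
  standard_finite_on_compact : forall K : set S, compact K -> lam K < +oo ;
  standard_positive_on_open : forall V : set S,
    open V -> V !=set0 -> 0 < lam V }.

(* The product measure lam^n, transported along S * S^n ~ S^(n+1). *)
Fixpoint power_measure lam (n : nat) : set (n.-tuple (borel S)) -> \bar R :=
  match n with
  | 0 => \d_([tuple] : 0.-tuple (borel S))
  | m.+1 => pushforward (lam \x @power_measure lam m)
      (fun z : borel S * m.-tuple (borel S) => [tuple of z.1 :: z.2])
  end.

Definition chains_below (n : nat) (x : S) : set (n.-tuple (borel S)) :=
  [set t : n.-tuple (borel S) | sorted <=%O (rcons (t : seq S) x)].

Definition cumulative_function lam (n : nat) (x : S) : \bar R :=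
  if n is 0 then 1 else power_measure lam (@chains_below n x).

Definition cumulative_generating_function lam (x : S) (t : R) : \bar R :=
  \sum_(0 <= n <oo) cumulative_function lam n x * (t ^+ n)%:E.

End standard_posets.

Section independence.
Context {R : realType} {d} {Omega : measurableType d} (P : probability Omega R).

Definition mutually_independent {d'} {T : measurableType d'}
    (Z : nat -> Omega -> T) : Prop :=
  forall (s : seq nat) (A : nat -> set T), uniq s ->
    (forall i, measurable (A i)) ->
    P (\bigcap_(i in [set` s]) (Z i @^-1` A i)) =
    \prod_(i <- s) P (Z i @^-1` A i).

Definition identically_distributed {d'} {T : measurableType d'}
    (Z : nat -> Omega -> T) : Prop :=
  forall (n : nat) (A : set T), measurable A ->
    P (Z n @^-1` A) = P (Z 0%N @^-1` A).

Definition generated_sigma_algebra {d'} {T : measurableType d'}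
    (Z : nat -> Omega -> T) : set (set Omega) :=
  <<s [set E | exists n (A : set T), measurable A /\ E = Z n @^-1` A] >>.

Definition independent_sequences {d1 d2} {T1 : measurableType d1}
    {T2 : measurableType d2} (Z1 : nat -> Omega -> T1)
    (Z2 : nat -> Omega -> T2) : Prop :=
  forall E1 E2 : set Omega,
    generated_sigma_algebra Z1 E1 -> generated_sigma_algebra Z2 E2 ->
    P (E1 `&` E2) = P E1 * P E2.

End independence.

Section distributions.
Context {R : realType} {d} {Omega : measurableType d} (P : probability Omega R).
Context {dS : Order.disp_t} {S : topPosetType dS}.
Implicit Types (lam : {measure set (borel S) -> \bar R}) (Z : Omega -> borel S).

Definition upper_probability Z (x : S) : \bar R :=
  P [set w | (x <= (Z w : S))%O].

Definition full_support Z : Prop :=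
  forall V : set S, open V -> V !=set0 -> 0 < P (Z @^-1` V).

Definition has_pdf lam Z (g : S -> \bar R) : Prop :=
  [/\ measurable_fun [set: Omega] Z,
      measurable_fun [set: borel S] g,
      forall x, 0 <= g x &
      forall A : set (borel S), measurable A ->
        P (Z @^-1` A) = \int[lam]_(x in A) g x].

Definition constant_rate lam Z (alpha : R) : Prop :=
  (0 < alpha)%R /\ has_pdf lam Z (fun x => alpha%:E * upper_probability Z x).

End distributions.

(* min A, with junk value 0 when A is empty. *)
Definition first_index (A : set nat) : nat :=
  xget 0%N [set k | A k /\ forall j, A j -> (k <= j)%N].

(* Sequences are indexed from 0, so that [X 0], [ladder_time X 0] and
   [ladder_variable X 0] are X_1, N_1 - 1 and Y_1. Under the hypotheses of the
   theorem the minima below exist almost surely. *)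
Section ladder.
Context {Omega : Type} {dS : Order.disp_t} {S : topPosetType dS}.
Variable X : nat -> Omega -> borel S.

Fixpoint ladder_time (n : nat) (w : Omega) : nat :=
  if n is m.+1 then
    first_index [set k | (ladder_time m w < k)%N /\
                         ((X (ladder_time m w) w : S) <= (X k w : S))%O]
  else 0%N.

Definition ladder_variable (n : nat) (w : Omega) : borel S :=
  X (ladder_time n w) w.

(* [J n w] means that the point [ladder_variable X n w] is accepted. *)
Definition first_accepted_time (J : nat -> Omega -> bool) (w : Omega) : nat :=
  first_index [set n | J n w].

Definition first_accepted_point (J : nat -> Omega -> bool) (w : Omega) :
    borel S :=
  ladder_variable (first_accepted_time J w) w.

End ladder.

(* Accept/reject marks of the points of Y: IID Bernoulli(p), independent of
   Y. *)
Definition thinning {R : realType} {d} {Omega : measurableType d}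
    (P : probability Omega R) {d'} {T : measurableType d'}
    (Y : nat -> Omega -> T) (J : nat -> {RV P >-> bool}) (p : R) : Prop :=
  [/\ forall n, P [set w | J n w] = p%:E,
      mutually_independent P J &
      independent_sequences P J Y].

(* Main.v *)
From HB Require Import structures.
Require Import Defs.
From mathcomp Require Import all_boot all_order all_algebra.
From mathcomp Require Import all_classical all_reals all_analysis.
From mathcomp Require Import measurable_realfun.
From mathcomp Require Import ring.

(** Write [F] for the upper probability function and [l_n] for the cumulative
functions.  The theorem follows from the fact that [Y_(n+1)] (the ladder
variable of index [n], counted from 0) has density
[alpha^n * l_n * (alpha * F)]: the index of the first accepted point is
geometric and independent of the ladder variables, so the density of the
accepted point is the mixture
[sum_n p (1-p)^n alpha^n l_n (alpha F) = p alpha Lambda(x, alpha (1-p)) F(x)].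

The density of the ladder variables is found by induction.  Given that a
record equals [y], the following observations are fresh copies of [X_1]; the
number of failures before one of them dominates [y] is geometric with success
probability [F y], and the one that succeeds has the law of [X_1] conditioned
to lie above [y].  Hence, for nonnegative [f],
[E f(Y_(n+2)) = E (K f)(Y_(n+1))], where
[K f y = (int_(z >= y) f z law(dz)) / F y].  This is [next_record] and
[integral_ladder_reachedS]; it rests on the independence of an observation
from the past ([past_independent]), on the integration of a function of two
independent variables one variable at a time ([integral_independent_pair]),
and on a geometric series ([series_integral_hitting]).

Constant rate makes this recursion collapse.  When the law of [X_1] has
density [alpha * F], the factor [F y] in the density of the current record
cancels the [1 / F y] of [K], and what remains is
[int l(y) int_(z >= y) f z alpha F z lam(dz) lam(dy)].  By Tonelli this is the
integral of [f * (alpha * F)] against [z |-> int_(y <= z) l(y) lam(dy)]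
([integral_left_right_adjoint]).  So each step of the induction integrates
over the points below, which is how the cumulative functions grow:
[l_n] is the [n]-fold iterate of this operator at the constant 1
([cumulative_functionE]).  The definition of the cumulative functions peels
off the smallest element of a chain whereas the induction adds a largest one,
and the same adjunction reconciles the two.

Two points of measure theory support this.  Second countability makes the
graph of the closed order a member of the product of the Borel sigma-algebras
([measurable_closed_relation]); with local compactness it makes the reference
measure sigma-finite ([standard_poset_sigma_finite]), so that Tonelli applies.
Finally, a record that is never beaten would give a junk value to the next
ladder time; this has probability zero, because [K 1 = 1] propagates total
mass one through the recursion ([ladder_reached_full]). *)

Set Implicit Arguments.
Unset Strict Implicit.
Unset Printing Implicit Defensive.

Import Order.TTheory GRing.Theory Num.Theory.

Local Open Scope classical_set_scope.
Local Open Scope ring_scope.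
Local Open Scope ereal_scope.

(** * Densities of measures *)

Section density.
Context {d} {T : measurableType d} {R : realType}.
Import HBNNSimple.

(** The density formula extends from indicators to nonnegative functions by
monotone approximation with simple functions.  Finiteness of the density makes
multiplication by its values continuous on the extended reals. *)
Lemma ge0_integral_density (mu nu : {measure set T -> \bar R})
    (g f : T -> \bar R) :
  measurable_fun setT g -> (forall x, 0 <= g x) ->
  (forall x, g x \is a fin_num) ->
  (forall A, measurable A -> nu A = \int[mu]_(x in A) g x) ->
  measurable_fun setT f -> (forall x, 0 <= f x) ->
  \int[nu]_x f x = \int[mu]_x (f x * g x).
Proof.
move=> mg g0 gfin nuE mf f0.
pose f_ := nnsfun_approx measurableT mf.
have f_cvg x : (f_ n x)%:E @[n --> \oo] --> f x.
  by apply: cvg_nnsfun_approx.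
have fE x : f x = limn (fun n => (f_ n x)%:E) by apply/esym/cvg_lim.
have nd_f x : {homo (fun n => (f_ n x)%:E) : n m / (n <= m)%N >-> (n <= m)%E}.
  by move=> n m nm; rewrite lee_fin; exact/lefP/nd_nnsfun_approx.
have mfn n : measurable_fun setT (fun x => (f_ n x)%:E).
  exact/measurable_EFinP/measurable_funP.
transitivity (limn (fun n => \int[nu]_x (f_ n x)%:E)).
  rewrite -monotone_convergence//.
  - by apply: eq_integral => x _; rewrite fE.
  - by move=> n x _; rewrite lee_fin.
transitivity (limn (fun n => \int[mu]_x ((f_ n x)%:E * g x))); last first.
  rewrite -monotone_convergence//.
  - apply: eq_integral => x _; apply/cvg_lim => //.
    exact: cvgeZr.
  - by move=> n; exact: emeasurable_funM.
  - by move=> n x _; rewrite mule_ge0// lee_fin.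
  - by move=> x _ n m nm; rewrite lee_wpmul2r// nd_f.
apply: congr_lim; apply/funext => n.
under [LHS]eq_integral do rewrite fimfunE -fsumEFin//.
rewrite [LHS]ge0_integral_fsum//; last 2 first.
  - by move=> r; exact/measurable_EFinP/measurableT_comp.
  - by move=> m x _; rewrite EFinM nnfun_muleindic_ge0.
under [RHS]eq_integral.
  move=> x _; rewrite fimfunE -fsumEFin// ge0_mule_fsuml; last first.
    by move=> r; rewrite EFinM nnfun_muleindic_ge0.
  over.
rewrite [RHS]ge0_integral_fsum//; last 2 first.
  - move=> r; apply: emeasurable_funM => //.
    by apply/measurable_EFinP; exact: measurableT_comp.
  - by move=> m x _; rewrite mule_ge0// EFinM nnfun_muleindic_ge0.
apply: eq_fsbigr => r _.
have mr : measurable (f_ n @^-1` [set r]) by exact: measurable_sfunP.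
under [RHS]eq_integral do rewrite EFinM -muleA.
rewrite integralZl_indic_nnsfun// integral_indic// setIT nuE//.
rewrite integral_mkcond.
have [r0|r0] := ltP r 0%R.
  have -> : f_ n @^-1` [set r] = set0.
    rewrite -subset0 => x /= fx; move: r0; rewrite -fx; apply/negP.
    by rewrite -leNgt.
  rewrite integral0_eq ?mule0; last by move=> x _; rewrite patchE in_set0.
  by rewrite integral0_eq// => x _; rewrite indic0 mul0e mule0.
rewrite ge0_integralZl_EFin//; last 2 first.
  - by move=> x _; rewrite mule_ge0// lee_fin.
  - by apply: emeasurable_funM => //; exact/measurable_EFinP/measurable_indic.
congr (_ * _); apply: eq_integral => x _.
by rewrite patchE indicE; case: ifP; rewrite ?mul1e ?mul0e.
Qed.

End density.

(** * Integrating out an independent variable *)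

Section independent_pair.
Context {R : realType} {d d1 d2 : measure_display} {Omega : measurableType d}.
Context {T1 : measurableType d1} {T2 : measurableType d2}.
Context (P : probability Omega R).

(** On the event [E], the pair [(W, Z)] has a product law: the law of [W] under
the restriction of [P] to [E], times the law of [Z].  The result is then
Tonelli for that product. *)
Lemma integral_independent_pair (E : set Omega) (W : {RV P >-> T1})
    (Z : {RV P >-> T2}) (f : T1 * T2 -> \bar R) :
  measurable E ->
  (forall A B, measurable A -> measurable B ->
    P (E `&` W @^-1` A `&` Z @^-1` B) =
    P (E `&` W @^-1` A) * P (Z @^-1` B)) ->
  measurable_fun setT f -> (forall z, 0 <= f z) ->
  \int[P]_(w in E) f (W w, Z w) =
  \int[P]_(w in E) \int[distribution P Z]_z f (W w, z).
Proof.
move=> mE indep mf f0.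
pose PE : {finite_measure set Omega -> \bar R} := mrestr P mE.
have restrE (h : Omega -> \bar R) : measurable_fun setT h ->
    (forall w, 0 <= h w) -> \int[P]_(w in E) h w = \int[PE]_w h w.
  move=> mh h0.
  rewrite (@ge0_integral_density _ _ _ P PE (fun w => (\1_E w)%:E))//.
  - rewrite [LHS]integral_mkcond; apply: eq_integral => w _.
    by rewrite patchE indicE; case: ifP; rewrite ?mule1 ?mule0.
  - exact/measurable_EFinP/measurable_indic.
  - move=> A mA; rewrite integral_indic//= /mrestr setIC//.
pose WZ w := (W w, Z w).
have mWZ : measurable_fun setT WZ by exact: measurable_fun_pair.
have mW : measurable_fun setT W by [].
have mZ : measurable_fun setT Z by [].
(* The image of a measure is a measure only under a measurable map: [push1]
   and [push12] take the proof that the map is measurable. *)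
pose push1 : {measure set T1 -> \bar R} := pushforward PE W.
pose m1 := push1 mW.
have m1fin : fin_num_fun m1.
  move=> A mA; apply: fin_num_measure.
  by rewrite -[X in measurable X]setTI; exact (mW measurableT _ mA).
pose m1' : {finite_measure set T1 -> \bar R} :=
  HB.pack (Measure.sort m1)
    (Measure_isFinite.Build _ _ _ (Measure.sort m1) m1fin).
pose m2 : probability T2 R := distribution P Z.
pose push12 : {measure set (T1 * T2) -> \bar R} := pushforward PE WZ.
pose m12 := push12 mWZ.
have m12E : forall C, measurable C -> (m1' \x m2) C = m12 C.
  apply: product_measure_unique => A B mA mB.
  rewrite /m12 /push12 /m1' /m1 /push1 /m2 /= /pushforward.
  rewrite /PE /= /mrestr /distribution /=.
  rewrite setIC [W @^-1` A `&` E]setIC -[RHS]indep//.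
  by congr (P _); apply/seteqP; split => w /=; tauto.
have mf1 : measurable_fun setT (f \o WZ) by exact: measurableT_comp.
rewrite restrE//.
rewrite (_ : \int[PE]_w f (W w, Z w) = \int[m12]_z f z); last first.
  rewrite ge0_integral_pushforward//.
rewrite (eq_measure_integral (m1' \x m2)); last first.
  by move=> C mC _; rewrite [RHS]m12E.
have mF := measurable_fun_fubini_tonelli_F (m2 := m2) f mf f0.
have F0 x : 0 <= fubini_F m2 f x by exact: integral_ge0.
rewrite fubini_tonelli1// restrE//.
- by rewrite [LHS]ge0_integral_pushforward.
- exact: (measurableT_comp mF mW).
- by move=> w; exact: (F0 (W w)).
Qed.

End independent_pair.

(** * Borel sets of a second countable ordered space *)

Section standard_poset_measurability.
Context {R : realType} {dS : Order.disp_t} {S : topPosetType dS}.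

Lemma second_countable_basis_seq : @second_countable S ->
  exists b : nat -> set S, (forall n, open (b n)) /\
    forall x U, nbhs x U -> exists2 n, b n x & b n `<=` U.
Proof.
move=> [B cB [Bopen Bnbhs]].
have hB x U : nbhs x U -> exists2 V, B V & V x /\ V `<=` U.
  by move=> /Bnbhs [V [BV Vx] VU]; exists V.
have [B0|/surjfunPex[b Bb]] := pfcard_geP cB.
  have [V BV _] := hB point setT filterT.
  by move: BV; rewrite B0.
exists b; split=> [n|x U /hB[V]]; first by apply: Bopen; rewrite Bb; exists n.
by rewrite Bb => -[n _ <-] [Vx VU]; exists n.
Qed.

Lemma open_borel_measurable (U : set S) :
  open U -> measurable (U : set (borel S)).
Proof. by move=> oU; exact: sub_sigma_algebra. Qed.

Lemma closed_borel_measurable (C : set S) :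
  closed C -> measurable (C : set (borel S)).
Proof.
move=> cC; rewrite -[C]setCK; apply: measurableC.
by apply: open_borel_measurable; exact: closed_openC.
Qed.

(** The complement of the graph is open, hence a union of products of open
sets; second countability makes countably many products of basic open sets
suffice, which puts it in the product of the Borel sigma-algebras. *)
Lemma measurable_closed_relation (r : rel S) : @second_countable S ->
  closed [set z : S * S | r z.1 z.2] ->
  measurable [set z : borel S * borel S | r z.1 z.2].
Proof.
move=> /second_countable_basis_seq [b [ob bnbhs]] cr.
set C := [set z : _ * _ | _].
have -> : C = ~` \bigcup_i \bigcup_j
    (if `[< b i `*` b j `<=` ~` C >] then b i `*` b j else set0).
  rewrite -[LHS]setCK; congr (~` _); apply/seteqP; split=> [[x y] nC|].
    have /= := closed_openC cr; rewrite openE => /(_ _ nC).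
    move=> [[U V] /= [Ux Vy] UV].
    have [i bix biU] := bnbhs _ _ Ux; have [j bjy bjV] := bnbhs _ _ Vy.
    exists i => //; exists j => //; rewrite asboolT//.
    by move=> [x' y'] /= [/biU ? /bjV ?]; exact: UV.
  by move=> z [i _ [j _]]; case: asboolP => // bC /bC.
apply: measurableC; apply: bigcupT_measurable => i.
apply: bigcupT_measurable => j; case: ifP => // _.
by apply: measurableX; exact: open_borel_measurable.
Qed.

(** Every point has a compact, closed neighborhood, hence one of finite measure,
and that neighborhood contains a basic open set around the point; so the basic
open sets of finite measure cover the space. *)
Lemma standard_poset_sigma_finite (lam : {measure set (borel S) -> \bar R}) :
  standard_poset lam -> sigma_finite setT lam.
Proof.
move=> hS; have [b [ob bnbhs]] :=
  second_countable_basis_seq (standard_second_countable hS).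
exists (fun n => if `[< lam (b n) < +oo >] then b n else set0).
  apply/esym; rewrite -subTset => x _.
  have [U] := @standard_locally_compact _ _ _ _ hS (x : S) Logic.I.
  move=> /(filterS (fun y (h : setT y -> U y) => h Logic.I)).
  move=> /bnbhs [n bx bU] [cU clU].
  exists n => //; rewrite asboolT//.
  apply: le_lt_trans (standard_finite_on_compact hS cU).
  apply: le_measure; rewrite ?inE//; last exact: closed_borel_measurable.
  exact: open_borel_measurable.
move=> n; case: asboolP => [fin|_]; last by rewrite measure0.
by split => //; exact: open_borel_measurable.
Qed.

End standard_poset_measurability.

(** * Integrals along a relation *)

Section relation_integrals.
Context {R : realType} {d : measure_display} {T : measurableType d}.
Variable r : rel T.
Hypothesis mr : measurable [set z : T * T | r z.1 z.2].

Lemma measurable_rel_left y : measurable [set x | r x y].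
Proof.
have := measurable_ysection y mr.
by congr measurable; apply/seteqP; split=> x /=; rewrite ysectionE.
Qed.

Lemma measurable_rel_right x : measurable [set y | r x y].
Proof.
have := measurable_xsection x mr.
by congr measurable; apply/seteqP; split=> y /=; rewrite xsectionE.
Qed.

Definition integral_left (mu : {measure set T -> \bar R}) (f : T -> \bar R)
  (y : T) : \bar R := \int[mu]_(x in [set x | r x y]) f x.

Definition integral_right (mu : {measure set T -> \bar R}) (f : T -> \bar R)
  (x : T) : \bar R := \int[mu]_(y in [set y | r x y]) f y.

Variable mu : {sigma_finite_measure set T -> \bar R}.

Section adjoint.
Variables (f g : T -> \bar R).
Hypotheses (mf : measurable_fun setT f) (mg : measurable_fun setT g).
Hypotheses (f0 : forall x, 0 <= f x) (g0 : forall x, 0 <= g x).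

Let h : T * T -> \bar R :=
  (fun z => f z.1 * g z.2) \_ [set z | r z.1 z.2].

Let mh : measurable_fun setT h.
Proof.
apply/(measurable_restrictT _ mr)/measurable_funTS.
by apply: emeasurable_funM; exact: measurableT_comp.
Qed.

Let h0 z : 0 <= h z.
Proof. by rewrite /h patchE; case: ifP => // _; rewrite mule_ge0. Qed.

Lemma integral_right_ge0 x : 0 <= integral_right mu g x.
Proof. exact: integral_ge0. Qed.

Lemma integral_left_ge0 x : 0 <= integral_left mu f x.
Proof. exact: integral_ge0. Qed.

Let hx x : \int[mu]_y h (x, y) = f x * integral_right mu g x.
Proof.
rewrite /integral_right -ge0_integralZl//; last 2 first.
- exact: measurable_rel_right.
- exact: measurable_funTS.
rewrite [RHS]integral_mkcond; apply: eq_integral => y _.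
by rewrite /h !patchE !mem_setE.
Qed.

Let hy y : \int[mu]_x h (x, y) = integral_left mu f y * g y.
Proof.
rewrite /integral_left -ge0_integralZr//; last 2 first.
- exact: measurable_rel_left.
- exact: measurable_funTS.
rewrite [RHS]integral_mkcond; apply: eq_integral => x _.
by rewrite /h !patchE !mem_setE.
Qed.

(** Both sides are the integral of [f x * g y] over the pairs related by [r]. *)
Lemma integral_left_right_adjoint :
  \int[mu]_x (f x * integral_right mu g x) =
  \int[mu]_y (integral_left mu f y * g y).
Proof.
under eq_integral do rewrite -hx.
by rewrite fubini_tonelli//; under eq_integral do rewrite hy.
Qed.

End adjoint.

Lemma measurable_integral_right g : measurable_fun setT g ->
  (forall x, 0 <= g x) -> measurable_fun setT (integral_right mu g).
Proof.
move=> mg g0; pose h : T * T -> \bar R := (g \o snd) \_ [set z | r z.1 z.2].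
have -> : integral_right mu g = fubini_F mu h.
  apply/funext => x; rewrite /integral_right integral_mkcond.
  by apply: eq_integral => y _; rewrite /h !patchE !mem_setE.
apply: measurable_fun_fubini_tonelli_F.
  apply/(measurable_restrictT _ mr)/measurable_funTS.
  exact: measurableT_comp.
by move=> z; rewrite /h patchE; case: ifP => //= _; exact: g0.
Qed.

Lemma measurable_integral_left f : measurable_fun setT f ->
  (forall x, 0 <= f x) -> measurable_fun setT (integral_left mu f).
Proof.
move=> mf f0; pose h : T * T -> \bar R := (f \o fst) \_ [set z | r z.1 z.2].
have -> : integral_left mu f = fubini_G mu h.
  apply/funext => y; rewrite /integral_left integral_mkcond.
  by apply: eq_integral => x _; rewrite /h !patchE !mem_setE.
apply: measurable_fun_fubini_tonelli_G.
  apply/(measurable_restrictT _ mr)/measurable_funTS.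
  exact: measurableT_comp.
by move=> z; rewrite /h patchE; case: ifP => //= _; exact: f0.
Qed.

End relation_integrals.

(** * The cumulative functions as iterated integrals *)

Lemma in_set_pred {T} (p : pred T) (x : T) : (x \in [set y | p y]) = p x.
Proof. by apply/idP/idP; rewrite inE. Qed.

Section cumulative_recursion.
Context {R : realType} {dS : Order.disp_t} {S : topPosetType dS}.

(** The order of [S], read on the type that carries the Borel sigma-algebra so
that the results on measurable relations apply to it. *)
Definition poset_rel : rel (borel S) := fun x y => ((x : S) <= (y : S))%O.

Lemma power_measure0 (lam : {measure set (borel S) -> \bar R}) n :
  power_measure lam (set0 : set (n.-tuple (borel S))) = 0.
Proof.
elim: n => [|n IHn] /=; first by rewrite diracE in_set0.
rewrite /pushforward preimage_set0 /product_measure1.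
by apply: integral0_eq => x _ /=; rewrite xsection0 IHn.
Qed.

(** Chains of length [n] that start above [a] and end below [x] are measured by
choosing their elements in increasing order, each one integrated over the
points above the previous one. *)
Lemma power_measure_chains (lam : {measure set (borel S) -> \bar R}) n
    (a x : S) :
  power_measure lam [set t : n.-tuple (borel S) |
    path <=%O a (rcons (t : seq S) x)] =
  iter n (integral_right poset_rel lam) (EFin \o \1_[set y | poset_rel y x]) a.
Proof.
elim: n a => [|n IHn] a /=.
  by rewrite diracE indicE !in_set_pred /= andbT.
rewrite /pushforward /product_measure1 [RHS]integral_mkcond.
apply: eq_integral => b _ /=; rewrite patchE in_set_pred -IHn.
have [ab|ab] := boolP (poset_rel a b).
  by congr power_measure; apply/seteqP; split=> t /=;
    rewrite xsectionE /= -[(a <= b)%O]/(poset_rel a b) ab.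
rewrite /= -[RHS](power_measure0 lam n); congr power_measure.
rewrite -subset0 => t /=.
by rewrite xsectionE /= -[(a <= b)%O]/(poset_rel a b) (negbTE ab).
Qed.

Lemma cumulative_functionS (lam : {measure set (borel S) -> \bar R}) n (x : S) :
  cumulative_function lam n.+1 x =
  \int[lam]_b iter n (integral_right poset_rel lam)
                (EFin \o \1_[set y | poset_rel y x]) b.
Proof.
rewrite /cumulative_function /= /pushforward /product_measure1.
apply: eq_integral => b _ /=; rewrite -power_measure_chains.
by congr power_measure; apply/seteqP; split=> t /=; rewrite xsectionE.
Qed.

Section iterated_left_integral.
Variable lam : {sigma_finite_measure set (borel S) -> \bar R}.
Hypothesis mr : measurable [set z : borel S * borel S | poset_rel z.1 z.2].

Let U := integral_left poset_rel lam.
Let V := integral_right poset_rel lam.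

Lemma iter_integral_left_ge0 n f :
  (forall x, 0 <= f x) -> forall x, 0 <= iter n U f x.
Proof. by move=> f0; elim: n => //= n IHn x; exact: integral_left_ge0. Qed.

Lemma measurable_iter_integral_left n f : measurable_fun setT f ->
  (forall x, 0 <= f x) -> measurable_fun setT (iter n U f).
Proof.
move=> mf f0; elim: n => //= n IHn; apply: measurable_integral_left => //.
exact: iter_integral_left_ge0.
Qed.

Lemma iter_integral_right_ge0 n f :
  (forall x, 0 <= f x) -> forall x, 0 <= iter n V f x.
Proof. by move=> f0; elim: n => //= n IHn x; exact: integral_right_ge0. Qed.

Lemma measurable_iter_integral_right n f : measurable_fun setT f ->
  (forall x, 0 <= f x) -> measurable_fun setT (iter n V f).
Proof.
move=> mf f0; elim: n => //= n IHn; apply: measurable_integral_right => //.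
exact: iter_integral_right_ge0.
Qed.

Lemma iter_integral_adjoint n f g :
  measurable_fun setT f -> measurable_fun setT g ->
  (forall x, 0 <= f x) -> (forall x, 0 <= g x) ->
  \int[lam]_x (f x * iter n V g x) = \int[lam]_x (iter n U f x * g x).
Proof.
move=> mf mg f0 g0; elim: n f mf f0 => // n IHn f mf f0.
rewrite [in RHS]iterSr -IHn; last 2 first.
- exact: measurable_integral_left.
- exact: integral_left_ge0.
rewrite -integral_left_right_adjoint//.
  exact: measurable_iter_integral_right.
exact: iter_integral_right_ge0.
Qed.

(** Moving the [n] integrations over upper sets across the adjunction turns them
into integrations over lower sets of the constant 1; the last integration, of
the indicator of the points below [x], is one more of these. *)
Lemma cumulative_functionE n (x : S) :
  cumulative_function lam n x = iter n U (cst 1) x.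
Proof.
case: n => // n; rewrite cumulative_functionS iterS.
have mle : measurable [set y | poset_rel y x] := measurable_rel_left mr x.
transitivity (\int[lam]_b (cst 1 b * iter n V
    (EFin \o \1_[set y | poset_rel y x]) b)).
  by apply: eq_integral => b _; rewrite mul1e.
rewrite iter_integral_adjoint//; last 2 first.
- exact/measurable_EFinP/measurable_indic.
- by move=> y; rewrite lee_fin.
rewrite /U /integral_left [RHS]integral_mkcond; apply: eq_integral => b _ /=.
by rewrite patchE indicE; case: ifP; rewrite ?mule1 ?mule0.
Qed.

End iterated_left_integral.
End cumulative_recursion.

(** * Independence of the past and the next observation *)

Section past.
Context {R : realType} {d d' : measure_display} {Omega : measurableType d}.
Context {T : measurableType d'} (P : probability Omega R).
Variable X : nat -> {RV P >-> T}.

Definition past_generators (i : nat) : set (set Omega) :=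
  [set E | exists l A, [/\ (l <= i)%N, measurable A & E = X l @^-1` A]].

(** The sample space with the sigma-algebra generated by [X 0, ..., X i], so
that the closure properties of measurable sets serve for events of the past. *)
Definition past (i : nat) := g_sigma_algebraType (past_generators i).

Lemma measurable_past_coordinate i l : (l <= i)%N ->
  measurable_fun setT (X l : past i -> T).
Proof.
move=> li _ A mA; rewrite setTI; apply: sub_sigma_algebra.
by exists l, A.
Qed.

Lemma past_subset i k (E : set Omega) : (i <= k)%N ->
  measurable (E : set (past i)) -> measurable (E : set (past k)).
Proof.
move=> ik; apply: sub_sigma_algebra2 => _ [l [A [li mA ->]]].
by exists l, A; split => //; exact: leq_trans ik.
Qed.

Lemma past_measurable i (E : set Omega) :
  measurable (E : set (past i)) -> measurable E.
Proof.
apply: smallest_sub; first exact: sigma_algebra_measurable.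
move=> _ [l [A [_ mA ->]]].
by rewrite -[X in measurable X]setTI; exact: (measurable_funP (X l)).
Qed.

Hypothesis X_indep : mutually_independent P X.

(** Dynkin's pi-lambda argument: the events that satisfy the product rule form a
Dynkin system, and mutual independence puts in it the intersections of
preimages under the first coordinates, which form a pi-system generating the
past. *)
Lemma past_independent i (E : set Omega) (B : set T) :
  measurable (E : set (past i)) -> measurable B ->
  P (E `&` X i.+1 @^-1` B) = P E * P (X i.+1 @^-1` B).
Proof.
move=> pE mB.
have mX l A : measurable A -> measurable (X l @^-1` A).
  move=> mA; rewrite -[X in measurable X]setTI.
  exact: (measurable_funP (X l)).
pose cyl (A : nat -> set T) :=
  \bigcap_(l in [set` iota 0 i.+1]) (X l @^-1` A l).
pose G := [set E | exists2 A, (forall l, measurable (A l)) & E = cyl A].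
pose H := [set E | measurable E /\
  P (E `&` X i.+1 @^-1` B) = P E * P (X i.+1 @^-1` B)].
have GI : setI_closed G.
  move=> _ _ [A mA ->] [A' mA' ->]; exists (fun l => A l `&` A' l).
    by move=> l; exact: measurableI.
  by rewrite /cyl -bigcapI; apply: eq_bigcapr => l _; rewrite preimage_setI.
have HD : dynkin H.
  split=> [|A [mA PA]|F tF FH].
  - by split=> //; rewrite setTI probability_setT mul1e.
  - split; first exact: measurableC.
    have -> : P (~` A `&` X i.+1 @^-1` B) =
        P (X i.+1 @^-1` B) - P (A `&` X i.+1 @^-1` B).
      rewrite setIC -setDE [in RHS]setIC measureD//; first exact: mX.
      by apply: le_lt_trans (probability_le1 P _) _; rewrite ?ltry//; exact: mX.
    rewrite PA probability_setC// -[P A]fineK ?fin_num_measure//.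
    rewrite -[P (_ @^-1` _)]fineK ?fin_num_measure//; last exact: mX.
    by rewrite -EFinM -!EFinB -EFinM mulrBl mul1r.
  - have mF n : measurable (F n) by have [] := FH n.
    split; first exact: bigcupT_measurable.
    rewrite setI_bigcupl !measure_bigcup//; first last.
    + exact: trivIset_setIr.
    + by move=> n _; apply: measurableI => //; exact: mX.
    rewrite -[P (_ @^-1` _)]fineK ?fin_num_measure//; last exact: mX.
    rewrite muleC -nneseriesZl//; apply: eq_eseriesr => n _.
    rewrite fineK; last by rewrite fin_num_measure//; exact: mX.
    by rewrite muleC; have [_] := FH n.
have GH : G `<=` H.
  move=> _ [A mA ->]; split.
    apply: bigcap_measurable => //; first by exists 0%N.
    by move=> l _; exact: mX.
  (* One instance of mutual independence covers the past and the next index. *)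
  pose A' l := if l == i.+1 then B else A l.
  have mA' l : measurable (A' l) by rewrite /A'; case: ifP.
  have is_uniq : uniq (rcons (iota 0 i.+1) i.+1).
    by rewrite rcons_uniq iota_uniq mem_iota ltnn.
  have A'E l : l \in iota 0 i.+1 -> A' l = A l.
    by rewrite mem_iota /A' => /andP[_ li]; rewrite ltn_eqF.
  have A'B : A' i.+1 = B by rewrite /A' eqxx.
  have := X_indep is_uniq mA'; rewrite -cats1 big_cat big_seq1 A'B.
  rewrite (eq_big_seq (fun l => P (X l @^-1` A l))); last first.
    by move=> l /A'E ->.
  rewrite -(X_indep (iota_uniq _ _) mA) => <-; congr (P _).
  have -> : [set` iota 0 i.+1 ++ [:: i.+1]] = [set` iota 0 i.+1] `|` [set i.+1].
    apply/seteqP; split=> l; rewrite /mkset mem_cat mem_seq1.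
      by case/orP => [|/eqP]; [left|right].
    by case=> [-> //|->]; rewrite eqxx orbT.
  rewrite bigcap_setU bigcap_set1 A'B; congr (_ `&` _).
  by apply: eq_bigcapr => l /A'E ->.
have pG : past_generators i `<=` G.
  move=> _ [l [A [li mA ->]]]; exists (fun k => if k == l then A else setT).
    by move=> k; case: ifP.
  apply/seteqP; split=> [w Aw k _ /=|w cw]; first by case: eqP => // ->.
  have : (if l == l then A else setT) (X l w).
    by apply: (cw l); rewrite /mkset mem_iota ltnS.
  by rewrite eqxx.
suff GsH : <<s G >> `<=` H by have [] := GsH _ (sub_sigma_algebra2 pG pE).
by apply: lambda_system_subset => //; exact/dynkin_lambda_system.
Qed.

End past.

(** * Waiting for a larger observation *)

Section geometric.
Context {R : realType}.

Lemma nneseries_geometric (q : R) : (0 < q <= 1)%R ->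
  \sum_(0 <= m <oo) ((1 - q) ^+ m)%:E = (q^-1)%:E.
Proof.
move=> /andP[q0 q1]; apply/cvg_lim => //.
have cv : (`|1 - q| < 1)%R.
  by rewrite ger0_norm ?subr_ge0// ltrBlDr ltrDl.
have := cvg_geometric_series (a := 1%R) cv.
rewrite subKr mul1r => h.
rewrite (_ : (fun n => _) = EFin \o series (geometric 1%R (1 - q)%R)).
  by apply/fine_cvgP; split; [exact: nearW|exact: h].
apply/funext => n /=; rewrite sumEFin; congr EFin.
by apply: eq_bigr => i _; rewrite /= mul1r.
Qed.

End geometric.

Section waiting.
Context {R : realType} {d d' : measure_display} {Omega : measurableType d}.
Context {T : measurableType d'} (P : probability Omega R).
Variables (X : nat -> {RV P >-> T}) (r : rel T).

Definition waiting (j m : nat) : set Omega :=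
  [set w | forall l, (j < l <= j + m)%N -> ~~ r (X j w) (X l w)].

(** Indexed by the number [m] of failures before the success, so that the events
for different [m] are disjoint. *)
Definition hitting (j m : nat) : set Omega :=
  waiting j m `&` [set w | r (X j w) (X (j + m).+1 w)].

Lemma hitting_inj j m m' w : hitting j m w -> hitting j m' w -> m = m'.
Proof.
wlog mm' : m m' / (m <= m')%N.
  move=> wl h h'; have [mm'|/ltnW m'm] := leqP m m'; first exact: wl.
  by apply/esym; exact: wl.
move=> [_ /= rm] [/(_ (j + m).+1) wait _]; apply/eqP; rewrite eqn_leq mm' /=.
rewrite leqNgt; apply/negP => lt_mm'; move: wait; rewrite rm/=.
by rewrite ltnS leq_addr -addnS leq_add2l lt_mm' => /(_ isT).
Qed.

Hypothesis mr : measurable [set z : T * T | r z.1 z.2].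

Lemma past_measurable_rel i j k : (j <= i)%N -> (k <= i)%N ->
  measurable ([set w | r (X j w) (X k w)] : set (past X i)).
Proof.
move=> ji ki.
have mjk : measurable_fun setT (fun w : past X i => (X j w, X k w)).
  by apply: measurable_fun_pair; exact: measurable_past_coordinate.
by have := mjk measurableT _ mr; rewrite setTI.
Qed.

Lemma waitingS j m : waiting j m.+1 =
  waiting j m `&` ~` [set w | r (X j w) (X (j + m).+1 w)].
Proof.
apply/seteqP; split=> w.
  move=> h; split=> [l /andP[jl lm]|].
    by apply: h; rewrite jl addnS leqW.
  by apply/negP/h; rewrite ltnS leq_addr addnS leqnn.
move=> [h /negP h'] l /andP[jl]; rewrite addnS leq_eqVlt => /orP[/eqP ->//|lm].
by apply: h; rewrite jl -ltnS.
Qed.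

Lemma waiting0 j : waiting j 0 = setT.
Proof.
apply/seteqP; split=> // w _ l; rewrite addn0 => /andP[jl lj].
by move: jl; rewrite ltnNge lj.
Qed.

Lemma past_measurable_waiting j m :
  measurable (waiting j m : set (past X (j + m))).
Proof.
elim: m => [|m IHm]; first by rewrite waiting0.
rewrite waitingS; apply: measurableI.
  by apply: past_subset IHm; rewrite leq_add2l.
apply: measurableC; apply: past_measurable_rel; rewrite addnS//.
by rewrite leqW// leq_addr.
Qed.

Lemma past_measurable_hitting j m :
  measurable (hitting j m : set (past X (j + m).+1)).
Proof.
apply: measurableI.
  by apply: past_subset (leqnSn _) _; exact: past_measurable_waiting.
by apply: past_measurable_rel => //; rewrite leqW// leq_addr.
Qed.

Hypothesis X_indep : mutually_independent P X.
Hypothesis X_ident : identically_distributed P X.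

Local Notation law := (distribution P (X 0%N)).

(** Given the past up to time [i], the next observation is a fresh copy of
[X 0]. *)
Lemma integral_past_next i j (E : set Omega) (f : T * T -> \bar R) :
  measurable (E : set (past X i)) -> (j <= i)%N ->
  measurable_fun setT f -> (forall z, 0 <= f z) ->
  \int[P]_(w in E) f (X j w, X i.+1 w) =
  \int[P]_(w in E) \int[law]_z f (X j w, z).
Proof.
move=> pE ji mf f0; rewrite integral_independent_pair//.
- apply: eq_integral => w _; apply: eq_measure_integral => A mA _.
  exact: X_ident.
- exact: past_measurable pE.
- move=> A B mA mB; apply: past_independent => //; apply: measurableI => //.
  rewrite -[X in measurable X]setTI.
  exact: (measurable_past_coordinate ji measurableT mA).
Qed.

Definition upper_law (y : T) : R := fine (law [set z | r y z]).

Lemma upper_lawE y : law [set z | r y z] = (upper_law y)%:E.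
Proof.
rewrite /upper_law fineK// fin_num_measure//; exact: measurable_rel_right.
Qed.

Lemma measurable_upper_law : measurable_fun setT upper_law.
Proof.
apply: measurableT_comp => //.
rewrite (_ : (fun y => law _) = law \o xsection [set z | r z.1 z.2]).
  exact: measurable_fun_xsection.
apply/funext => y /=; congr (law _).
by apply/seteqP; split=> z; rewrite xsectionE.
Qed.

Lemma upper_law_le1 y : (upper_law y <= 1)%R.
Proof.
by rewrite -lee_fin -upper_lawE probability_le1//; exact: measurable_rel_right.
Qed.

Let miss_ge0 y m : 0 <= ((1 - upper_law y) ^+ m)%:E.
Proof. by rewrite lee_fin exprn_ge0// subr_ge0 upper_law_le1. Qed.

Let mmiss m : measurable_fun setT (fun y => ((1 - upper_law y) ^+ m)%:E).
Proof.
apply/measurable_EFinP; apply: measurable_funX; apply: measurable_funB => //.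
exact: measurable_upper_law.
Qed.

(** Each failure to go above [X j] is an independent trial, of conditional
probability [1 - upper_law (X j)], and contributes one factor. *)
Lemma integral_waiting j m (E : set Omega) (f : T -> \bar R) :
  measurable (E : set (past X j)) ->
  measurable_fun setT f -> (forall y, 0 <= f y) ->
  \int[P]_(w in E `&` waiting j m) f (X j w) =
  \int[P]_(w in E) (f (X j w) * ((1 - upper_law (X j w)) ^+ m)%:E).
Proof.
move=> pE; elim: m f => [|m IHm] f mf f0.
  by rewrite waiting0 setIT; apply: eq_integral => w _; rewrite expr0 mule1.
rewrite waitingS setIA integral_mkcondr.
pose g : T * T -> \bar R := (f \o fst) \_ (~` [set z | r z.1 z.2]).
have mg : measurable_fun setT g.
  apply/(measurable_restrictT _ (measurableC mr))/measurable_funTS.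
  exact: measurableT_comp.
have g0 z : 0 <= g z by rewrite /g patchE; case: ifP => //= _; exact: f0.
transitivity (\int[P]_(w in E `&` waiting j m) g (X j w, X (j + m).+1 w)).
  by apply: eq_integral => w _; rewrite /g !patchE !in_setC !mem_setE.
rewrite integral_past_next//; last 2 first.
- apply: measurableI; last exact: past_measurable_waiting.
  by apply: past_subset pE; rewrite leq_addr.
- exact: leq_addr.
transitivity (\int[P]_(w in E `&` waiting j m)
    (f (X j w) * (1 - upper_law (X j w))%:E)).
  apply: eq_integral => w _.
  rewrite EFinB -upper_lawE -probability_setC; last exact: measurable_rel_right.
  rewrite -(setIT (~` _)) -integral_indic//; last first.
    by apply: measurableC; exact: measurable_rel_right.
  rewrite -ge0_integralZl//; last first.
    apply/measurable_EFinP/measurable_indic; apply: measurableC.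
    exact: measurable_rel_right.
  apply: eq_integral => z _; rewrite /g patchE indicE !in_setC !in_set_pred /=.
  by case: (r _ _) => /=; rewrite ?mule0 ?mule1.
rewrite (IHm (fun y => f y * (1 - upper_law y)%:E)).
- by apply: eq_integral => w _; rewrite -muleA -EFinM -exprS.
- by apply: emeasurable_funM => //; exact: (mmiss 1).
- by move=> y; rewrite mule_ge0//; exact: (miss_ge0 y 1).
Qed.

(** After [m] failed trials comes a successful one, whose value is distributed
as [X 0] on the points above [X j]. *)
Lemma integral_hitting j m (E : set Omega) (f : T -> \bar R) :
  measurable (E : set (past X j)) ->
  measurable_fun setT f -> (forall y, 0 <= f y) ->
  \int[P]_(w in E `&` hitting j m) f (X (j + m).+1 w) =
  \int[P]_(w in E) (integral_right r law f (X j w) *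
                    ((1 - upper_law (X j w)) ^+ m)%:E).
Proof.
move=> pE mf f0; rewrite /hitting setIA integral_mkcondr.
pose g : T * T -> \bar R := (f \o snd) \_ [set z | r z.1 z.2].
have mg : measurable_fun setT g.
  apply/(measurable_restrictT _ mr)/measurable_funTS.
  exact: measurableT_comp.
have g0 z : 0 <= g z by rewrite /g patchE; case: ifP => //= _; exact: f0.
transitivity (\int[P]_(w in E `&` waiting j m) g (X j w, X (j + m).+1 w)).
  by apply: eq_integral => w _; rewrite /g !patchE !mem_setE.
rewrite integral_past_next//; last 2 first.
- apply: measurableI; last exact: past_measurable_waiting.
  by apply: past_subset pE; rewrite leq_addr.
- exact: leq_addr.
rewrite -integral_waiting//; last 2 first.
- exact: measurable_integral_right.
- exact: integral_right_ge0.
apply: eq_integral => w _; rewrite /integral_right [RHS]integral_mkcond.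
by apply: eq_integral => z _; rewrite /g !patchE !mem_setE.
Qed.

Hypothesis upper_law_gt0 : forall y, (0 < upper_law y)%R.

(** The transition operator of the record process: the mean of [f] at a variable
distributed as [X 0] conditioned to be above [y]. *)
Definition next_record (f : T -> \bar R) (y : T) : \bar R :=
  integral_right r law f y * ((upper_law y)^-1)%:E.

Lemma next_record_ge0 f :
  (forall y, 0 <= f y) -> forall y, 0 <= next_record f y.
Proof.
move=> f0 y; rewrite mule_ge0//; first exact: integral_right_ge0.
by rewrite lee_fin invr_ge0 ltW.
Qed.

(** The reciprocal is measurable as the sum of a geometric series of measurable
functions. *)
Lemma measurable_next_record f : measurable_fun setT f ->
  (forall y, 0 <= f y) -> measurable_fun setT (next_record f).
Proof.
move=> mf f0; apply: emeasurable_funM; first exact: measurable_integral_right.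
rewrite (_ : (fun y => _) =
    (fun y => \sum_(0 <= m <oo) ((1 - upper_law y) ^+ m)%:E)).
  by apply: ge0_emeasurable_sum.
apply/funext => y.
by rewrite nneseries_geometric// upper_law_gt0 upper_law_le1.
Qed.

(** Since [next_record] preserves the constant 1, a next record comes with
probability one. *)
Lemma next_record1 y : next_record (cst 1) y = 1.
Proof.
rewrite /next_record /integral_right integral_cst; last first.
  exact: measurable_rel_right.
by rewrite mul1e [X in X * _]upper_lawE -EFinM divff// gt_eqF.
Qed.

(** Summing over the waiting time replaces the powers of [1 - upper_law] by a
geometric series of sum [1 / upper_law]. *)
Lemma series_integral_hitting j (E : set Omega) (f : T -> \bar R) :
  measurable (E : set (past X j)) ->
  measurable_fun setT f -> (forall y, 0 <= f y) ->
  \sum_(0 <= m <oo) \int[P]_(w in E `&` hitting j m) f (X (j + m).+1 w) =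
  \int[P]_(w in E) next_record f (X j w).
Proof.
move=> pE mf f0; have mE := past_measurable pE.
have mV := measurable_integral_right mr law mf f0.
under eq_eseriesr do rewrite integral_hitting//.
rewrite -integral_nneseries//; last 2 first.
- move=> m; apply: measurable_funTS; apply: emeasurable_funM.
    exact: measurableT_comp.
  exact: (measurableT_comp (mmiss m)).
- by move=> m w _; rewrite mule_ge0//; exact: integral_right_ge0.
apply: eq_integral => w _; rewrite /next_record.
have [q0 q1] := (upper_law_gt0 (X j w), upper_law_le1 (X j w)).
rewrite -nneseries_geometric ?q0//.
have := integral_right_ge0 r law f0 (X j w).
case: (integral_right _ _ _ _) => [v _|_|//]; first by rewrite nneseriesZl.
rewrite nneseries_geometric ?q0// gt0_mulye ?lte_fin ?invr_gt0//.
(* When the integral above [X j] is infinite, so is the term of index 0. *)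
apply: (nneseries_pinfty (k := 0%N)) => //; last by rewrite expr0 mule1.
by move=> m _; rewrite mule_ge0.
Qed.

End waiting.

(** * Random indices *)

Section random_index.

Lemma first_index_eq (A : set nat) k :
  A k -> (forall j, A j -> (k <= j)%N) -> first_index A = k.
Proof.
move=> Ak kmin; rewrite /first_index; apply: xget_unique => // l [Al lmin].
by apply/eqP; rewrite eqn_leq lmin//= kmin.
Qed.

(** The second alternative accounts for the default value 0 of [first_index] at
the empty set. *)
Lemma first_indexP (A : set nat) k : first_index A = k <->
  (A k /\ forall j, (j < k)%N -> ~ A j) \/ (k = 0%N /\ forall j, ~ A j).
Proof.
split=> [<-|[[Ak kmin]|[-> A0]]]; last 2 first.
- apply: first_index_eq => // j Aj; rewrite leqNgt; apply/negP => jk.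
  exact: kmin jk Aj.
- by rewrite /first_index; apply: xgetPN => l [Al _]; exact: A0 Al.
have [A0|] := pselect (forall j, ~ A j).
  by right; split => //; apply: xgetPN => l [Al _]; exact: A0 Al.
move=> /existsNP [j /contrapT Aj]; left.
have exA : exists j, `[< A j >] by exists j; exact/asboolP.
have [i /asboolP Ai imin] := ex_minnP exA.
have -> : first_index A = i.
  by apply: first_index_eq => // l Al; apply: imin; exact/asboolP.
split=> // l li Al; have := imin l (asboolT Al).
by rewrite leqNgt li.
Qed.

Context {d : measure_display} {Omega : measurableType d}.

Lemma measurable_first_index (A : Omega -> set nat) :
  (forall k, measurable [set w | A w k]) ->
  forall k, measurable [set w | first_index (A w) = k].
Proof.
move=> mA k.
have -> : [set w | first_index (A w) = k] =
  ([set w | A w k] `&` \bigcap_(j in `I_k) ~` [set w | A w j]) `|`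
  (if k == 0%N then \bigcap_j ~` [set w | A w j] else set0).
  apply/seteqP; split=> w /=.
    move=> /first_indexP[[Ak kmin]|[-> A0]]; last by right=> j _; exact: A0.
    by left; split=> // j /= /kmin.
  move=> h; apply/first_indexP; case: h => [[Ak kmin]|]; first by left.
  by case: eqP => // -> A0; right; split => // j; exact: A0.
apply: measurableU.
  apply: measurableI => //.
  have [->|k0] := eqVneq k 0%N; first by rewrite II0 bigcap_set0.
  apply: bigcap_measurable; first by exists 0%N; rewrite /= lt0n.
  by move=> j _; exact: measurableC.
by case: ifP => // _; apply: bigcapT_measurable => j; exact: measurableC.
Qed.

Lemma measurable_random_index {d'} {T : measurableType d'}
    (N : Omega -> nat) (Z : nat -> Omega -> T) :
  (forall k, measurable [set w | N w = k]) ->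
  (forall k, measurable_fun setT (Z k)) ->
  measurable_fun setT (fun w => Z (N w) w).
Proof.
move=> mN mZ _ A mA; rewrite setTI.
have -> : (fun w => Z (N w) w) @^-1` A =
    \bigcup_k ([set w | N w = k] `&` Z k @^-1` A).
  by apply/seteqP; split=> [w ZA|w [k _ [<-]]//]; exists (N w).
apply: bigcupT_measurable => k; apply: measurableI => //.
by rewrite -[X in measurable X]setTI; exact: mZ.
Qed.

End random_index.

(** * Ladder events *)

Section ladder_events.
Context {R : realType} {d : measure_display} {Omega : measurableType d}.
Context {dS : Order.disp_t} {S : topPosetType dS} (P : probability Omega R).
Variable X : nat -> {RV P >-> borel S}.

Local Notation r := (@poset_rel dS S).

(** The event that all ladder times up to the one of index [n] exist and that
this one equals [k].  It is contained in the event [ladder_time X n = k], which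
may also contain paths where an earlier minimum took its default value 0;
unlike the latter, it belongs to the past up to time [k]. *)
Fixpoint ladder_at (n k : nat) : set Omega :=
  if n is n'.+1 then
    \bigcup_j \bigcup_m
      (if k == (j + m).+1 then ladder_at n' j `&` hitting X r j m else set0)
  else if k == 0%N then setT else set0.

Lemma ladder_at_time n k w : ladder_at n k w -> ladder_time X n w = k.
Proof.
elim: n k => [|n IHn] k /=; first by case: eqP.
move=> [j _ [m _]]; case: eqP => // -> [/IHn -> [wait hit]].
apply: first_index_eq; first by split; [rewrite ltnS leq_addr|exact: hit].
move=> l [jl rl]; rewrite ltnNge; apply/negP => lm.
by have := wait l; rewrite jl lm => /(_ isT); rewrite /poset_rel rl.
Qed.

Definition ladder_reached (n : nat) : set Omega := \bigcup_j ladder_at n j.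

Lemma ladder_reachedS n : ladder_reached n.+1 =
  \bigcup_j \bigcup_m (ladder_at n j `&` hitting X r j m).
Proof.
apply/seteqP; split=> w.
  by move=> [k _ [j _ [m _]]]; case: eqP => // _ h; exists j => //; exists m.
move=> [j _ [m _ h]]; exists (j + m).+1 => //; exists j => //; exists m => //.
by rewrite eqxx.
Qed.

Lemma ladder_reached0 : ladder_reached 0 = setT.
Proof. by apply/seteqP; split=> // w _; exists 0%N. Qed.

Lemma ladder_variable_next n j m w : ladder_at n j w -> hitting X r j m w ->
  ladder_variable X n.+1 w = X (j + m).+1 w.
Proof.
move=> nj jm; rewrite /ladder_variable (_ : ladder_time _ _ _ = (j + m).+1)//.
by apply: ladder_at_time; exists j => //; exists m => //; rewrite eqxx.
Qed.

Hypothesis mr : measurable [set z : borel S * borel S | r z.1 z.2].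

Lemma past_measurable_ladder_at n k :
  measurable (ladder_at n k : set (past X k)).
Proof.
elim: n k => [|n IHn] k /=; first by case: ifP.
apply: bigcupT_measurable => j; apply: bigcupT_measurable => m.
case: eqP => // ->; apply: measurableI; last exact: past_measurable_hitting.
by apply: past_subset (IHn j); rewrite leqW// leq_addr.
Qed.

Lemma measurable_ladder_at n k : measurable (ladder_at n k).
Proof.
apply: (past_measurable (X := X) (i := k)).
exact: past_measurable_ladder_at.
Qed.

Lemma trivIset_ladder_at n : trivIset setT (ladder_at n).
Proof.
move=> i j _ _ [w [/ladder_at_time + /ladder_at_time]] => /= -> ->//.
Qed.

Lemma measurable_ladder_time n k : measurable [set w | ladder_time X n w = k].
Proof.
elim: n k => [|n IHn] k /=.
  by have [->|/eqP k0] := eqVneq k 0%N;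
    [rewrite (_ : [set _ | _] = setT)|rewrite (_ : [set _ | _] = set0)] => //;
    apply/seteqP; split=> // w /= h; case: k0.
pose A j w := [set k | (j < k)%N /\ r (X j w) (X k w)].
have -> : [set w | ladder_time X n.+1 w = k] =
    \bigcup_j ([set w | ladder_time X n w = j] `&`
               [set w | first_index (A j w) = k]).
  apply/seteqP; split=> [w /= h|w [j _ [/= <-]] //].
  by exists (ladder_time X n w).
apply: bigcupT_measurable => j; apply: measurableI => //.
apply: measurable_first_index => l.
have [jl|lj] := ltnP j l.
  have -> : [set w | A j w l] = [set w | r (X j w) (X l w)].
    by apply/seteqP; split=> w; [case|split].
  exact: past_measurable (past_measurable_rel mr (leq_maxl j l) (leq_maxr j l)).
rewrite (_ : [set w | A j w l] = set0)// -subset0 => w [/=].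
by rewrite ltnNge lj.
Qed.

Lemma measurable_ladder_variable n : measurable_fun setT (ladder_variable X n).
Proof.
by apply: measurable_random_index => //; exact: measurable_ladder_time.
Qed.

End ladder_events.

(** * Events of probability one *)

Section full_probability.
Context {R : realType} {d : measure_display} {Omega : measurableType d}.
Context (P : probability Omega R).

Lemma probability_setI_full (A B : set Omega) :
  measurable A -> measurable B -> P B = 1 -> P (A `&` B) = P A.
Proof.
move=> mA mB PB.
have PCB : P (~` B) = 0 by rewrite probability_setC// PB subee.
have PAB : P (A `\` B) = 0.
  have mAB : measurable (A `\` B) by exact: measurableD.
  exact: (subset_measure0 mAB (measurableC mB) _ PCB).
have -> : P A = P (A `\` B) + P (A `&` B) by exact: measureDI.
by rewrite PAB add0e.
Qed.

Lemma probability_partition (A : set Omega) (D : nat -> set Omega) :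
  measurable A -> (forall n, measurable (D n)) -> trivIset setT D ->
  \sum_(0 <= n <oo) P (D n) = 1 ->
  P A = \sum_(0 <= n <oo) P (D n `&` A).
Proof.
move=> mA mD tD D1.
have mU : measurable (\bigcup_n D n) by exact: bigcupT_measurable.
rewrite -(@probability_setI_full A (\bigcup_n D n))//; last first.
  by rewrite measure_semi_bigcup.
have mDA n : measurable (D n `&` A) by exact: measurableI.
rewrite setIC setI_bigcupl measure_semi_bigcup//; first exact: trivIset_setIr.
exact: bigcupT_measurable.
Qed.

End full_probability.

(** * The law of the ladder variables *)

Section ladder_law.
Context {R : realType} {d : measure_display} {Omega : measurableType d}.
Context {dS : Order.disp_t} {S : topPosetType dS} (P : probability Omega R).
Variable X : nat -> {RV P >-> borel S}.

Local Notation r := (@poset_rel dS S).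
Local Notation Y := (ladder_variable X).
Local Notation law := (distribution P (X 0%N)).
Local Notation F := (upper_law X r).

Hypothesis mr : measurable [set z : borel S * borel S | r z.1 z.2].
Hypothesis X_indep : mutually_independent P X.
Hypothesis X_ident : identically_distributed P X.
Hypothesis F_gt0 : forall y, (0 < F y)%R.

(** The event that [Y n.+1] exists splits according to the time [j] of the
[n]-th record and the number [m] of failures after it; for each [j] the sum
over [m] is [series_integral_hitting], since [ladder_at X n j] belongs to the
past up to [j]. *)
Lemma integral_ladder_reachedS n (f : borel S -> \bar R) :
  measurable_fun setT f -> (forall y, 0 <= f y) ->
  \int[P]_(w in ladder_reached X n.+1) f (Y n.+1 w) =
  \int[P]_(w in ladder_reached X n) next_record X r f (Y n w).
Proof.
move=> mf f0.
have mY k : measurable_fun setT (Y k) by exact: measurable_ladder_variable.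
have mL j : measurable (ladder_at X n j) by exact: measurable_ladder_at.
have mH j m : measurable (hitting X r j m).
  apply: (past_measurable (X := X) (i := (j + m).+1)).
  exact: past_measurable_hitting.
have mLH j m : measurable (ladder_at X n j `&` hitting X r j m).
  exact: measurableI.
rewrite ladder_reachedS ge0_integral_bigcup//.
- rewrite /ladder_reached ge0_integral_bigcup//.
  + apply: eq_eseriesr => j _.
    rewrite ge0_integral_bigcup//.
    * transitivity (\sum_(0 <= m <oo)
          \int[P]_(w in ladder_at X n j `&` hitting X r j m)
             f (X (j + m).+1 w)).
        apply: eq_eseriesr => m _; apply: eq_integral => w /[1!inE] -[nj jm].
        by rewrite (ladder_variable_next nj jm).
      rewrite series_integral_hitting//; last exact: past_measurable_ladder_at.
      apply: eq_integral => w /[1!inE] nj.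
      by rewrite /ladder_variable (ladder_at_time nj).
    * by apply: measurable_funTS; exact: measurableT_comp.
    * move=> m m' _ _ [w [[_ +] [_]]]; exact: hitting_inj.
  + apply: measurable_funTS; apply: measurableT_comp => //.
    exact: measurable_next_record.
  + by move=> w _; exact: next_record_ge0.
  + exact: trivIset_ladder_at.
- by move=> j; exact: bigcupT_measurable.
- by apply: measurable_funTS; exact: measurableT_comp.
- move=> j j' _ _ [w [[m _ [nj _]] [m' _ [nj' _]]]].
  by rewrite -(ladder_at_time nj) -(ladder_at_time nj').
Qed.

Lemma measurable_ladder_reached n : measurable (ladder_reached X n).
Proof. by apply: bigcupT_measurable => j; exact: measurable_ladder_at. Qed.

(** The total mass of the event is the integral of 1, which the transition
operator preserves. *)
Lemma ladder_reached_full n : P (ladder_reached X n) = 1.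
Proof.
have PE k : P (ladder_reached X k) =
    \int[P]_(w in ladder_reached X k) cst 1 (Y k w).
  by rewrite integral_cst ?mul1e//; exact: measurable_ladder_reached.
elim: n => [|n IHn]; first by rewrite ladder_reached0 probability_setT.
rewrite PE integral_ladder_reachedS// -[RHS]IHn PE.
by apply: eq_integral => w _; exact: next_record1.
Qed.

Lemma ladder_variable_prob n (A : set (borel S)) : measurable A ->
  P (Y n @^-1` A) = \int[P]_(w in ladder_reached X n) (\1_A (Y n w))%:E.
Proof.
move=> mA; have mYA : measurable (Y n @^-1` A).
  rewrite -[X in measurable X]setTI.
  exact: (measurable_ladder_variable X mr n measurableT mA).
have mL := measurable_ladder_reached n.
have -> : P (Y n @^-1` A) = P (Y n @^-1` A `&` ladder_reached X n).
  by rewrite probability_setI_full// ladder_reached_full.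
by rewrite -integral_indic.
Qed.

Variable lam : {sigma_finite_measure set (borel S) -> \bar R}.
Variable alpha : R.
Hypothesis alpha_gt0 : (0 < alpha)%R.
Hypothesis X_pdf : forall A : set (borel S), measurable A ->
  law A = \int[lam]_(x in A) (alpha * F x)%:E.

Let mg : measurable_fun setT (fun x => (alpha * F x)%:E).
Proof.
apply/measurable_EFinP; apply: measurable_funM => //.
exact: measurable_upper_law.
Qed.

Let g_ge0 x : 0 <= (alpha * F x)%:E.
Proof. by rewrite lee_fin mulr_ge0// ltW. Qed.

Lemma integral_law f : measurable_fun setT f -> (forall x, 0 <= f x) ->
  \int[law]_x f x = \int[lam]_x (f x * (alpha * F x)%:E).
Proof. by move=> mf f0; exact: ge0_integral_density. Qed.

Lemma integral_right_law f y : measurable_fun setT f -> (forall x, 0 <= f x) ->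
  integral_right r law f y =
  integral_right r lam (fun x => f x * (alpha * F x)%:E) y.
Proof.
move=> mf f0; rewrite /integral_right integral_mkcond.
rewrite integral_law; last 2 first.
- apply/(measurable_restrictT _ (measurable_rel_right mr y)).
  exact: measurable_funTS.
- by move=> x; rewrite patchE; case: ifP.
rewrite [RHS]integral_mkcond; apply: eq_integral => x _; rewrite !patchE.
by case: ifP; rewrite ?mul0e.
Qed.

(** The induction step cancels [F x] against the normalization in [next_record],
and the adjunction moves the integral over the points above [x] from [f] to
the cumulative function. *)
Lemma integral_ladder_variable n f :
  measurable_fun setT f -> (forall x, 0 <= f x) ->
  \int[P]_(w in ladder_reached X n) f (Y n w) =
  \int[lam]_x (f x *
    ((alpha ^+ n)%:E * cumulative_function lam n x * (alpha * F x)%:E)).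
Proof.
elim: n f => [|n IHn] f mf f0.
  rewrite ladder_reached0 -(ge0_integral_distribution (X 0%N) mf f0).
  rewrite integral_law//; apply: eq_integral => x _.
  by rewrite expr0 !mul1e.
rewrite integral_ladder_reachedS// IHn; last 2 first.
- exact: measurable_next_record.
- exact: next_record_ge0.
pose l := iter n (integral_left r lam) (cst 1).
have l0 : forall x, 0 <= l x by exact: iter_integral_left_ge0.
have ml : measurable_fun setT l by exact: measurable_iter_integral_left.
pose fg x := f x * (alpha * F x)%:E.
have mfg : measurable_fun setT fg by exact: emeasurable_funM.
have fg0 x : 0 <= fg x by rewrite mule_ge0.
have a0 m : (0 <= alpha ^+ m)%R by rewrite exprn_ge0// ltW.
transitivity ((alpha ^+ n.+1)%:E *
    \int[lam]_x (l x * integral_right r lam fg x)).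
  rewrite -ge0_integralZl_EFin//; last 2 first.
  - by move=> x _; rewrite mule_ge0//; exact: integral_right_ge0.
  - by apply: emeasurable_funM => //; exact: measurable_integral_right.
  apply: eq_integral => x _.
  rewrite /next_record integral_right_law// -/fg cumulative_functionE// -/l.
  rewrite -muleA [RHS]muleA [RHS]muleC; congr (_ * _).
  rewrite [X in _ * X]muleAC muleA -!EFinM; congr (_%:E * _).
  by rewrite mulrC -!mulrA divff ?gt_eqF// mulr1 exprSr.
rewrite integral_left_right_adjoint// -ge0_integralZl_EFin//; last 2 first.
- by move=> x _; rewrite mule_ge0//; exact: integral_left_ge0.
- by apply: emeasurable_funM => //; exact: measurable_integral_left.
apply: eq_integral => x _; rewrite cumulative_functionE// iterS -/l /fg.
by rewrite [_ * (f x * _)]muleCA [LHS]muleCA !muleA.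
Qed.

End ladder_law.

(** * Thinning *)

Section first_acceptance.
Context {R : realType} {d : measure_display} {Omega : measurableType d}.
Context (P : probability Omega R) (J : nat -> {RV P >-> bool}) (p : R).

(** The mark [J n] is the first one to be true: [i == n] is the value required
of the mark of index [i <= n].  Stated as an intersection of preimages, it is
ready for the independence of the marks. *)
Definition accepted_first_at (n : nat) : set Omega :=
  \bigcap_(i in [set` iota 0 n.+1]) (J i @^-1` [set i == n]).

Lemma accepted_first_atP n w :
  accepted_first_at n w <-> (J n w /\ forall i, (i < n)%N -> ~~ J i w).
Proof.
split=> [h|[Jn Jlt] i].
  have hi i : (i <= n)%N -> J i w = (i == n).
    by move=> le_in; apply: h; rewrite /mkset mem_iota ltnS.
  by split=> [|i lt_in]; rewrite hi// ?eqxx ?ltn_eqF// ltnW.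
rewrite /mkset mem_iota add0n ltnS => /andP[_].
rewrite leq_eqVlt => /orP[/eqP ->|lt_in] /=.
  by rewrite eqxx.
by rewrite ltn_eqF//; apply/negbTE; exact: Jlt.
Qed.

Lemma accepted_first_at_time n w :
  accepted_first_at n w -> first_accepted_time J w = n.
Proof.
move=> /accepted_first_atP[Jn Jlt]; apply: first_index_eq => // i /= Ji.
by rewrite leqNgt; apply/negP => /Jlt; rewrite Ji.
Qed.

Lemma trivIset_accepted_first_at : trivIset setT accepted_first_at.
Proof.
by move=> i j _ _ [w [/accepted_first_at_time <- /accepted_first_at_time <-]].
Qed.

(** Membership in the sigma-algebra of the marks is what makes the event
independent of the ladder variables. *)
Lemma accepted_first_at_generated n :
  generated_sigma_algebra J (accepted_first_at n).
Proof.
pose G := [set E | exists i (A : set bool), measurable A /\ E = J i @^-1` A].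
suff : measurable (accepted_first_at n : set (g_sigma_algebraType G)) by [].
apply: bigcap_measurable; first by exists 0%N.
by move=> i _; apply: sub_sigma_algebra; exists i, [set i == n].
Qed.

Lemma measurable_accepted_first_at n : measurable (accepted_first_at n).
Proof.
apply: bigcap_measurable; first by exists 0%N.
move=> i _; rewrite -[X in measurable X]setTI.
exact: (measurable_funP (J i)).
Qed.

Hypothesis J_prob : forall n, P [set w | J n w] = p%:E.
Hypothesis J_indep : mutually_independent P J.

Lemma accepted_first_at_prob n :
  P (accepted_first_at n) = (p * (1 - p) ^+ n)%:E.
Proof.
have mJ i : measurable [set w | J i w].
  by rewrite -[X in measurable X]setTI; exact: (measurable_funP (J i)).
rewrite /accepted_first_at.
rewrite (J_indep (iota_uniq 0 n.+1) (A := fun i => [set i == n]))//.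
rewrite -addn1 iotaD big_cat big_seq1 add0n eqxx J_prob EFinM muleC.
congr (_ * _).
transitivity (\prod_(i <- iota 0 n) (1 - p)%:E).
  apply: eq_big_seq => i; rewrite mem_iota add0n => /andP[_ lt_in].
  rewrite ltn_eqF// EFinB -(J_prob i) -probability_setC//; congr (P _).
  by apply/seteqP; split=> w /=; case: (J i w).
elim: n => [|n IHn]; first by rewrite big_nil.
by rewrite -addn1 iotaD big_cat big_seq1 IHn exprD.
Qed.

End first_acceptance.

Section thinned_ladder.
Context {R : realType} {d : measure_display} {Omega : measurableType d}.
Context {dS : Order.disp_t} {S : topPosetType dS} (P : probability Omega R).
Variables (X : nat -> {RV P >-> borel S}) (J : nat -> {RV P >-> bool}).
Variables (lam : {sigma_finite_measure set (borel S) -> \bar R}) (alpha p : R).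

Local Notation r := (@poset_rel dS S).
Local Notation law := (distribution P (X 0%N)).
Local Notation F := (upper_law X r).

Hypothesis mr : measurable [set z : borel S * borel S | r z.1 z.2].
Hypothesis X_indep : mutually_independent P X.
Hypothesis X_ident : identically_distributed P X.
Hypothesis F_gt0 : forall y, (0 < F y)%R.
Hypothesis alpha_gt0 : (0 < alpha)%R.
Hypothesis X_pdf : forall A : set (borel S), measurable A ->
  law A = \int[lam]_(x in A) (alpha * F x)%:E.
Hypothesis p01 : (0 < p < 1)%R.
Hypothesis J_thin : thinning (ladder_variable X) J p.

Lemma measurable_first_accepted_point :
  measurable_fun setT (first_accepted_point X J).
Proof.
apply: (measurable_random_index (N := first_accepted_time J)) => n.
  apply: measurable_first_index => k.
  by rewrite -[X in measurable X]setTI; exact: (measurable_funP (J k)).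
exact: measurable_ladder_variable.
Qed.

Lemma cumulative_function_ge0 n (x : S) : 0 <= cumulative_function lam n x.
Proof. by rewrite cumulative_functionE//; exact: iter_integral_left_ge0. Qed.

Lemma measurable_cumulative_function n :
  measurable_fun [set: borel S] (cumulative_function lam n).
Proof.
rewrite (_ : cumulative_function lam n =
             iter n (integral_left r lam) (cst 1)); last first.
  by apply/funext => x; rewrite cumulative_functionE.
exact: measurable_iter_integral_left.
Qed.

Let beta := (alpha * (1 - p))%R.
Let beta_ge0 : (0 <= beta)%R.
Proof. by have /andP[_ p1] := p01; rewrite mulr_ge0 ?subr_ge0// ltW. Qed.

Let term_ge0 n (x : S) : 0 <= cumulative_function lam n x * (beta ^+ n)%:E.
Proof.
by rewrite mule_ge0 ?cumulative_function_ge0// lee_fin exprn_ge0.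
Qed.

Lemma thinned_density_ge0 (x : S) :
  0 <= (p * alpha)%:E * cumulative_generating_function lam x beta * (F x)%:E.
Proof.
have /andP[p0 _] := p01; apply: mule_ge0; last by rewrite lee_fin ltW.
apply: mule_ge0; first by rewrite lee_fin mulr_ge0// ltW.
by apply: nneseries_ge0 => n _ _; exact: term_ge0.
Qed.

Let mterm n : measurable_fun [set: borel S]
  (fun x => cumulative_function lam n x * (beta ^+ n)%:E).
Proof.
by apply: emeasurable_funM => //; exact: measurable_cumulative_function.
Qed.

Lemma measurable_thinned_density : measurable_fun [set: borel S] (fun x : S =>
  (p * alpha)%:E * cumulative_generating_function lam x beta * (F x)%:E).
Proof.
apply: emeasurable_funM; last first.
  by apply/measurable_EFinP; exact: measurable_upper_law.
apply: emeasurable_funM => //.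
by apply: ge0_emeasurable_sum.
Qed.

(** The events [accepted_first_at J n] have total probability 1, so the law of
the accepted point is the mixture of the laws of the ladder variables with
geometric weights; monotone convergence moves the sum under the integral. *)
Lemma first_accepted_point_prob (A : set (borel S)) : measurable A ->
  P (first_accepted_point X J @^-1` A) = \int[lam]_(x in A)
    ((p * alpha)%:E * cumulative_generating_function lam x beta * (F x)%:E).
Proof.
move=> mA; have [J_prob J_indep JY] := J_thin.
have /andP[p0 p1] := p01.
have q0 : (0 <= 1 - p)%R by rewrite subr_ge0 ltW.
have mYM : measurable (first_accepted_point X J @^-1` A).
  rewrite -[X in measurable X]setTI.
  exact: measurable_first_accepted_point.
have mD := measurable_accepted_first_at J.
have tD := trivIset_accepted_first_at (J := J).
rewrite (probability_partition mYM mD tD); last first.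
  under eq_eseriesr do rewrite (accepted_first_at_prob J_prob J_indep) EFinM.
  rewrite nneseriesZl; last by move=> n _; rewrite lee_fin exprn_ge0.
  by rewrite nneseries_geometric ?p0 ?ltW// -EFinM divff// gt_eqF.
pose h n x := (\1_A x)%:E *
  ((alpha ^+ n)%:E * cumulative_function lam n x * (alpha * F x)%:E).
have h_ge0 n x : 0 <= h n x.
  rewrite /h mule_ge0 ?lee_fin// mule_ge0//; last first.
    by rewrite lee_fin mulr_ge0// ltW.
  by rewrite mule_ge0 ?cumulative_function_ge0// lee_fin exprn_ge0// ltW.
have mh n : measurable_fun setT (h n).
  apply: emeasurable_funM; first exact/measurable_EFinP/measurable_indic.
  apply: emeasurable_funM.
    by apply: emeasurable_funM => //; exact: measurable_cumulative_function.
  apply/measurable_EFinP; apply: measurable_funM => //.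
  exact: measurable_upper_law.
transitivity (\sum_(0 <= n <oo) \int[lam]_x ((p * (1 - p) ^+ n)%:E * h n x)).
  apply: eq_eseriesr => n _.
  have -> : accepted_first_at J n `&` first_accepted_point X J @^-1` A =
            accepted_first_at J n `&` ladder_variable X n @^-1` A.
    by apply/seteqP; split=> w [Dn /=];
      rewrite /first_accepted_point (accepted_first_at_time Dn).
  rewrite JY; last 2 first.
  - exact: accepted_first_at_generated.
  - by apply: sub_sigma_algebra; exists n, A.
  rewrite (accepted_first_at_prob J_prob J_indep) ladder_variable_prob//.
  rewrite (integral_ladder_variable (lam := lam) (alpha := alpha)
    mr X_indep X_ident F_gt0 alpha_gt0 X_pdf n (f := fun x => (\1_A x)%:E))//.
  rewrite ge0_integralZl_EFin//.
  - by rewrite mulr_ge0 ?exprn_ge0// ltW.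
  - exact/measurable_EFinP/measurable_indic.
rewrite -integral_nneseries//; last 2 first.
- by move=> n; exact: emeasurable_funM.
- by move=> n x _; rewrite mule_ge0// lee_fin mulr_ge0 ?exprn_ge0// ltW.
rewrite [RHS]integral_mkcond; apply: eq_integral => x _.
rewrite patchE /h indicE; case: ifP => _; last first.
  by rewrite eseries0// => n _ _; rewrite mul0e mule0.
rewrite /cumulative_generating_function muleAC -EFinM -nneseriesZl//.
apply: eq_eseriesr => n _; rewrite mul1e.
rewrite [X in _ * X]muleAC muleA -!EFinM muleC [RHS]muleCA -EFinM.
congr (_ * _%:E); rewrite /beta exprMn; ring.
Qed.

End thinned_ladder.

Theorem proposition9 (R : realType)
  (dS : Order.disp_t) (S : topPosetType dS)
  (lam : {measure set (borel S) -> \bar R})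
  (d : measure_display) (Omega : measurableType d) (P : probability Omega R)
  (X : nat -> {RV P >-> borel S}) (J : nat -> {RV P >-> bool}) (alpha p : R)
  (hS : standard_poset lam)
  (hX_indep : mutually_independent P X)
  (hX_ident : identically_distributed P X)
  (hX_support : full_support P (X 0%N))
  (hX_upper : forall x : S, 0 < upper_probability P (X 0%N) x <= 1)
  (hX_rate : constant_rate P lam (X 0%N) alpha)
  (hp : (0 < p < 1)%R)
  (hJ : thinning (ladder_variable X) J p) :
  has_pdf P lam (first_accepted_point X J)
    (fun x : S => (p * alpha)%:E * cumulative_generating_function lam x (alpha * (1 - p)) *
                  upper_probability P (X 0%N) x).
Proof.
have mr : measurable [set z : borel S * borel S | poset_rel z.1 z.2].
  apply: (@measurable_closed_relation _ _ (fun x y : S => (x <= y)%O)).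
    exact: standard_second_countable hS.
  exact: standard_closed_order hS.
have lam_sigma_finite := standard_poset_sigma_finite hS.
pose sfin := isSFinite.Build _ _ _ _
  (sfinite_measure_sigma_finite lam_sigma_finite).
pose sigmafin := isSigmaFinite.Build _ _ _ _ lam_sigma_finite.
pose lam' : {sigma_finite_measure set (borel S) -> \bar R} :=
  HB.pack_for (SigmaFiniteMeasure.type (borel S) R) (Measure.sort lam)
    sfin sigmafin.
(* The same set function, packaged with its sigma-finiteness. *)
have lamE : lam = lam' by exact: eq_measure.
have upperE x : upper_probability P (X 0%N) x = (upper_law X poset_rel x)%:E.
  exact: upper_lawE.
have F_gt0 y : (0 < upper_law X poset_rel y)%R.
  by have /andP[] := hX_upper y; rewrite upperE.
have [alpha_gt0 [_ _ _ X_pdf]] := hX_rate.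
have law_pdf A : measurable A -> distribution P (X 0%N) A =
    \int[lam']_(x in A) (alpha * upper_law X poset_rel x)%:E.
  move=> mA; rewrite [LHS]X_pdf//; apply: eq_integral => x _.
  by rewrite upperE EFinM.
rewrite (_ : (fun x : S => _) = (fun x : S => (p * alpha)%:E *
    cumulative_generating_function lam' x (alpha * (1 - p)) *
    (upper_law X poset_rel x)%:E)); last first.
  by apply/funext => x; rewrite upperE -lamE.
split.
- exact: measurable_first_accepted_point.
- exact: measurable_thinned_density.
- exact: thinned_density_ge0.
- by move=> A mA; exact: first_accepted_point_prob.
Qed.
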